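(* Let $(X,\mathsf d,\mathfrak m)$ be an $\mathsf{RCD}(K,N)$-space with $K\in\mathbb R$ and $N\in[1,+\infty)$, and let $p\in[1,+\infty)$. Then $\mathrm{Lip}(X)_{\rm bs}\subset W^{2,p}_\ast(X)$. If moreover $\mathfrak m$ has finite $p$th moment, i.e. $\int_X\mathsf d(x,x_0)^p\,d\mathfrak m(x)<\infty$ for some $x_0\in X$, then $\mathrm{Lip}(X)\subset W^{2,p}_\ast(X)$.
   Context: A metric measure space $(X,\mathsf{d},\mathfrak{m})$ consists of a complete separable metric space $(X,\mathsf d)$ and a nonzero nonnegative Borel measure $\mathfrak m$, finite on bounded sets, with $\mathfrak m(B_r(x))>0$ for every open ball. Write $L^p(X)=L^p(X;\mathfrak m)$. $\mathrm{Lip}(X)$ is the set of functions $f:X\to\mathbb R$ with finite global Lipschitz constant, and $\mathrm{Lip}(X)_{\rm bs}$ the subset of those vanishing identically outside a bounded set. Test plans. $C([0,1],X)$ is the space of continuous curves with the sup distance, and $\mathsf e_t(\gamma)=\gamma_t$. For $q\in(1,+\infty]$, $AC^q([0,1],X)$ is the set of curves $\gamma$ for which there is $g\in L^q([0,1])$ with $\mathsf d(\gamma_t,\gamma_s)\le\int_s^t g\,dr$ for $s<t$; its metric speed is $|\dot\gamma_t|=\lim_{h\downarrow0}\mathsf d(\gamma_{t+h},\gamma_t)/h$ (and $+\infty$ when the limit does not exist). A Borel probability measure $\boldsymbol\pi$ on $C([0,1],X)$ is a $q$-test plan if there is $C>0$ with $(\mathsf e_t)_\sharp\boldsymbol\pi\le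 C\mathfrak m$ for all $t\in[0,1]$, and: if $q<\infty$, $\int \mathsf{Ke}_q(\gamma)\,\boldsymbol\pi(d\gamma)<\infty$ where $\mathsf{Ke}_q(\gamma)=\int_0^1|\dot\gamma_t|^q\,dt$ if $\gamma\in AC^q$ and $+\infty$ otherwise; if $q=\infty$, the Lipschitz constant $\mathrm{Lip}(\gamma)$ belongs to $L^\infty(\boldsymbol\pi)$. Weak upper gradients and Sobolev spaces. Let $p\in[1,+\infty)$, with conjugate exponent $q=p/(p-1)$ ($q=\infty$ if $p=1$). For a Borel function $f$ on $X$, a nonnegative Borel function $G$ is a $p$-weak upper gradient of $f$, written $G\in\mathcal{UG}^p(f)$, if $\int|f(\gamma_1)-f(\gamma_0)|\,\boldsymbol\pi(d\gamma)\le\int\int_0^1G(\gamma_t)|\dot\gamma_t|\,dt\,\boldsymbol\pi(d\gamma)$ for every $q$-test plan $\boldsymbol\pi$. $S^p(X)$ is the set of $f$ with $\mathcal{UG}^p(f)\cap L^p(X)\neq\emptyset$, and $W^{1,p}(X)=L^p(X)\cap S^p(X)$. Modified second order Sobolev space. $W^{2,p}_\ast(X)=\{f\in W^{1,p}(X): \mathcal{UG}^p(f)\cap W^{1,p}(X)\neq\emptyset\}$. RCD spaces. For $f\in S^2(X)$ let $|Df|$ be the $\mathfrak m$-a.e. minimal element of $\mathcal{UG}^2(f)\cap L^2(X)$. $(X,\mathsf d,\mathfrak m)$ is infinitesimally Hilbertian if $W^{1,2}(X)$, with norm $(\|f\|_{L^2}^2+\||Df|\|_{L^2}^2)^{1/2}$,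 is a Hilbert space; then $\langle Df,Dg\rangle=\frac14|D(f+g)|^2-\frac14|D(f-g)|^2$, $\mathscr E(f,g)=\int\langle Df,Dg\rangle\,d\mathfrak m$, and $\Delta$ is the $L^2$-Laplacian: $u\in D(\Delta)$ with $\Delta u=w\in L^2(X)$ iff $u\in W^{1,2}(X)$ and $\mathscr E(u,v)=-\int wv\,d\mathfrak m$ for all $v\in W^{1,2}(X)$. $(X,\mathsf d,\mathfrak m)$ is an $\mathsf{RCD}(K,\infty)$-space if (i) it is infinitesimally Hilbertian; (ii) $\mathfrak m(B_r(x_0))\le Ce^{cr^2}$ for some $x_0\in X$, $c,C>0$ (all $r>0$); (iii) every $f\in W^{1,2}(X)$ with $|Df|\le1$ $\mathfrak m$-a.e. has a $1$-Lipschitz representative; (iv) $\frac12\int|Df|^2\Delta g\,d\mathfrak m-\int\langle Df,D\Delta f\rangle g\,d\mathfrak m\ge K\int|Df|^2g\,d\mathfrak m$ for all $f\in D(\Delta)$ with $\Delta f\in W^{1,2}(X)$ and all $g\in D(\Delta)\cap L^\infty(X)$ with $g\ge0$, $\Delta g\in L^\infty(X)$. It is an $\mathsf{RCD}(K,N)$-space, $N\in[1,+\infty)$, if moreover (iv) holds with the additional term $\frac1N\int(\Delta f)^2g\,d\mathfrak m$ on the right-hand side. *)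

(* Defs.v *)
From HB Require Import structures.
From mathcomp Require Import all_boot all_order all_algebra.
From mathcomp Require Import all_classical all_reals all_analysis.
From mathcomp Require Import measurable_realfun lebesgue_stieltjes_measure.
From mathcomp Require Import ess_sup_inf ring lra.

Set Implicit Arguments.
Unset Strict Implicit.
Unset Printing Implicit Defensive.

Import Order.TTheory GRing.Theory Num.Theory.
Import numFieldNormedType.Exports.

Local Open Scope classical_set_scope.
Local Open Scope ring_scope.

#[short(type="completeMetricType")]
HB.structure Definition CompleteMetric (K : numDomainType) :=
  {T of Complete T & Metric K T}.

Notation borel T := (g_sigma_algebraType (@open T)).

Notation I01 R := (set_type [set` `[(0 : R)%R, (1 : R)%R]]).

Section clamp.
Context {R : realType}.

Lemma clamp_subproof (t : R) : Num.max 0 (Num.min 1 t) \in [set` `[0%R, (1 : R)]].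
Proof.
by rewrite inE /= in_itv /= le_max lexx /= ge_max ler01 ge_min lexx.
Qed.

(* Retraction of R onto [0,1], used to evaluate a curve at a real time. *)
Definition clamp (t : R) : I01 R :=
  exist (fun x => x \in [set` `[0%R, (1 : R)]]) _ (clamp_subproof t).

Lemma clampK (t : I01 R) : clamp (val t) = t.
Proof.
apply/val_inj => /=; have := valP t; rewrite inE /= in_itv /= => /andP[t0 t1].
by rewrite min_r// max_r.
Qed.

Lemma clamp_continuous : continuous clamp.
Proof.
apply: (@continuous_comp_initial _ _ _ (set_val : I01 R -> R)) => t.
apply: (@continuous_max _ _ (cst 0) (fun t : R => Num.min 1 t)).
  exact: cvg_cst.
by apply: (@continuous_min _ _ (cst 1) id); [exact: cvg_cst|exact: cvg_id].
Qed.

End clamp.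

Section curve.
Context {R : realType} (X : metricType R).

(* C([0,1],X); [curve_dist] below is the sup distance. *)
Definition curve := continuousType (I01 R) X.

Implicit Types g h k : curve.

HB.instance Definition _ := Choice.on curve.

Definition curve_dist g h : R := sup (range (fun t => mdist (g t) (h t))).

Lemma curve_dist_has_sup g h : has_sup (range (fun t => mdist (g t) (h t))).
Proof.
split; first by exists (mdist (g (clamp 0)) (h (clamp 0))), (clamp 0).
have cont : continuous (fun t : R => mdist (g (clamp t)) (h (clamp t))).
  move=> t; apply/cvgrPdist_le => e e0.
  have e20 : 0 < e / 2 by rewrite divr_gt0.
  have cc (f : curve) : \forall s \near t,
      mdist (f (clamp t)) (f (clamp s)) <= e / 2.
    have cft : (f \o clamp) s @[s --> t] --> (f \o clamp) t.
      by apply: continuous_comp; [exact: clamp_continuous|exact: cts_fun].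
    exact: metricType_numDomainType.cvgr_dist_le cft _ e20.
  near=> s.
  have gs : mdist (g (clamp t)) (g (clamp s)) <= e / 2 by near: s; exact: cc.
  have hs : mdist (h (clamp t)) (h (clamp s)) <= e / 2 by near: s; exact: cc.
  have := metric_triangle (g (clamp t)) (g (clamp s)) (h (clamp t)).
  have := metric_triangle (g (clamp s)) (h (clamp s)) (h (clamp t)).
  have := metric_triangle (g (clamp s)) (g (clamp t)) (h (clamp s)).
  have := metric_triangle (g (clamp t)) (h (clamp t)) (h (clamp s)).
  move: gs hs; rewrite (metric_sym (g (clamp s)) (g (clamp t))).
  rewrite (metric_sym (h (clamp s)) (h (clamp t))) ler_norml => *.
  apply/andP; split; lra.
have [c _ cmax] : exists2 c, c \in `[0, 1]%R & forall t, t \in `[0, 1]%R ->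
    mdist (g (clamp t)) (h (clamp t)) <= mdist (g (clamp c)) (h (clamp c)).
  by apply: EVT_max => //; exact: continuous_subspaceT.
exists (mdist (g (clamp c)) (h (clamp c))) => _ [t _ <-].
by rewrite -(clampK t); apply: cmax; have := valP t; rewrite inE.
Unshelve. all: by end_near. Qed.

Lemma mdist_le_curve_dist g h t : mdist (g t) (h t) <= curve_dist g h.
Proof.
by apply: sup_upper_bound; [exact: curve_dist_has_sup|exists t].
Qed.

Lemma curve_dist_le g h e :
  (forall t, mdist (g t) (h t) <= e) -> curve_dist g h <= e.
Proof.
move=> ghe; apply: ge_sup; first by have [] := curve_dist_has_sup g h.
by move=> _ [t _ <-].
Qed.

Lemma curve_distxx g : curve_dist g g = 0.
Proof.
apply/eqP; rewrite eq_le; apply/andP; split.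
  by apply: curve_dist_le => t; rewrite mdistxx.
by rewrite (le_trans _ (mdist_le_curve_dist g g (clamp 0)))// mdistxx.
Qed.

Lemma curve_dist_positivity g h : curve_dist g h = 0 -> g = h.
Proof.
move=> gh0; apply/continuousEP => t; apply: (@mdist_positivity R).
apply/eqP; rewrite eq_le mdist_ge0 andbT.
by rewrite (le_trans (mdist_le_curve_dist g h t))// gh0.
Qed.

Lemma curve_dist_sym g h : curve_dist g h = curve_dist h g.
Proof. by congr sup; apply: eq_imagel => t _; rewrite metric_sym. Qed.

Lemma curve_dist_triangle h g k :
  curve_dist g k <= curve_dist g h + curve_dist h k.
Proof.
apply: curve_dist_le => t; rewrite (le_trans (metric_triangle _ (h t) _))//.
by rewrite lerD// mdist_le_curve_dist.
Qed.

HB.instance Definition _ := @isMetric.Build R curve curve_dist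
  curve_distxx curve_dist_positivity curve_dist_sym curve_dist_triangle.

End curve.

HB.instance Definition _ (R : realType) (X : completeMetricType R) :=
  isPointed.Build (curve X) (cst point : continuousType (I01 R) X).

Section curve_speed.
Context {R : realType} (X : metricType R).
Local Open Scope ereal_scope.

(* lim_(h -> 0+) d(g_(t+h), g_t) / h, and +oo if there is no limit. Because of
   [clamp], the value at t = 1 is 0; it is only ever used under an integral
   over [0,1]. *)
Definition metric_speed (g : curve X) (t : R) : \bar R :=
  let q h := ((mdist (g (clamp (t + h))) (g (clamp t)) / h)%R)%:E in
  if `[< cvg (q h @[h --> 0%R^'+]) >] then lim (q h @[h --> 0%R^'+]) else +oo.

Definition abs_continuous (q : \bar R) (g : curve X) : Prop :=
  exists2 s : R -> R,
    s \in Lfun (mrestr lebesgue_measure (measurable_itv `[0%R, (1%R : R)])) q &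
    forall t u : I01 R, (val t < val u)%R ->
      (mdist (g u) (g t))%:E <=
      \int[lebesgue_measure]_(r in [set` `[val t, val u]]) (s r)%:E.

Definition kinetic_energy (q : R) (g : curve X) : \bar R :=
  if `[< abs_continuous q%:E g >] then
    \int[lebesgue_measure]_(t in [set` `[0%R, 1%R]]) (metric_speed g t `^ q)
  else +oo.

Definition curve_lip (g : curve X) : \bar R :=
  ereal_sup [set z | exists t u : I01 R, (val t < val u)%R /\
                     z = (mdist (g t) (g u) / (val u - val t))%:E].

End curve_speed.

Section mms.
Context {R : realType} (X : completeMetricType R).

Definition metric_bounded (A : set X) : Prop :=
  exists x r, A `<=` ball x r.

Definition Lipschitz_with (L : R) (f : X -> R) : Prop :=
  forall x y, `|f x - f y| <= L * mdist x y.

Definition Lip : set (X -> R) := [set f | exists L, Lipschitz_with L f].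

Definition Lip_bs : set (X -> R) :=
  [set f | Lip f /\
           exists2 B, metric_bounded B & forall x, ~ B x -> f x = 0].

Variable m : {measure set (borel X) -> \bar R}.

Definition metric_measure_space : Prop :=
  [/\ exists2 D : set X, countable D & dense D,
      m setT != 0%E,
      forall A : set (borel X), measurable A -> metric_bounded A ->
        (m A < +oo)%E &
      forall (x : X) (r : R), 0 < r -> (0 < m (ball x r))%E].

(* For the nonnegative function Ke_q, integrability is measurability, which its
   integral presupposes, together with finiteness of the integral. *)
Definition test_plan (q : \bar R) (pi : probability (borel (curve X)) R) : Prop :=
  (exists2 C : R, 0 < C &
     forall (t : I01 R) (A : set (borel X)), measurable A ->
       (pushforward pi (fun g : borel (curve X) => g t : borel X) A
        <= C%:E * m A)%E) /\
  match q with
  | r%:E => pi.-integrable setT (kinetic_energy r : borel (curve X) -> \bar R)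
  | +oo%E =>
      measurable_fun [set: borel (curve X)] (@curve_lip R X) /\
      ('N[pi]_+oo[@curve_lip R X] < +oo)%E
  | -oo%E => False
  end.

(* The elements of UG, Lp, W1, W2star are Borel functions, i.e. representatives
   of the usual m-a.e. equivalence classes. *)
Definition UG (p : R) (f : X -> R) : set (X -> R) := [set G |
  [/\ measurable_fun setT (f : borel X -> R),
      measurable_fun setT (G : borel X -> R),
      forall x, 0 <= G x &
      forall pi : probability (borel (curve X)) R,
        test_plan (hoelder_conjugate p%:E) pi ->
        (\int[pi]_g (`|f (g (clamp 1%R)) - f (g (clamp 0%R))|%:E) <=
         \int[pi]_g \int[lebesgue_measure]_(t in [set` `[0%R, (1%R : R)]])
           ((G (g (clamp t)))%:E * metric_speed g t))%E]].

Definition Lp (p : \bar R) : set (X -> R) :=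
  [set f | (f : borel X -> R) \in Lfun m p].

Definition Sobolev_class (p : R) : set (X -> R) :=
  [set f | UG p f `&` Lp p%:E !=set0].

Definition W1 (p : R) : set (X -> R) := Lp p%:E `&` Sobolev_class p.

Definition W2star (p : R) : set (X -> R) :=
  [set f | W1 p f /\ UG p f `&` W1 p !=set0].

Definition minimal_wug (f : X -> R) : set (X -> R) :=
  [set G | (UG 2 f `&` Lp 2%:E) G /\
     forall G', (UG 2 f `&` Lp 2%:E) G' ->
       {ae m, forall x : borel X, G x <= G' x}].

(* |Df|, as a representative of the m-a.e. unique minimal element. *)
Definition wgrad (f : X -> R) : X -> R := xget (cst 0) (minimal_wug f).

Definition W12_norm (f : X -> R) : R :=
  Num.sqrt (fine 'N[m]_2%:E[EFin \o f] ^+ 2 +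
            fine 'N[m]_2%:E[EFin \o wgrad f] ^+ 2).

(* [W12_norm] is a norm on the a.e. classes, hence a seminorm on representatives;
   [ip] then descends to the classes by the Cauchy-Schwarz inequality. *)
Definition infinitesimally_Hilbertian : Prop :=
  (exists ip : (X -> R) -> (X -> R) -> R,
    [/\ forall f g, W1 2 f -> W1 2 g -> ip f g = ip g f,
        forall a f g h, W1 2 f -> W1 2 g -> W1 2 h ->
          ip (fun x => a * f x + g x) h = a * ip f h + ip g h &
        forall f, W1 2 f -> W12_norm f ^+ 2 = ip f f]) /\
  (forall u : nat -> X -> R, (forall n, W1 2 (u n)) ->
     (forall e, 0 < e ->
        \forall i & j \near \oo, W12_norm (u i \- u j) < e) ->
     exists2 l, W1 2 l & W12_norm (u n \- l) @[n --> \oo] --> (0 : R)).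

Definition grad_ip (f g : X -> R) : X -> R := fun x =>
  4^-1 * wgrad (f \+ g) x ^+ 2 - 4^-1 * wgrad (f \- g) x ^+ 2.

Definition Dirichlet (f g : X -> R) : R := \int[m]_x grad_ip f g x.

(* u is in D(Delta) and w represents Delta u. *)
Definition is_laplacian (u w : X -> R) : Prop :=
  [/\ W1 2 u, Lp 2%:E w &
      forall v, W1 2 v -> Dirichlet u v = - \int[m]_x (w x * v x)].

Definition volume_growth : Prop :=
  exists (x0 : X) (c C : R), [/\ 0 < c, 0 < C &
    forall r, 0 < r -> (m (ball x0 r) <= (C * expR (c * r ^+ 2))%:E)%E].

Definition Sobolev_to_Lipschitz : Prop :=
  forall f, W1 2 f -> {ae m, forall x : borel X, wgrad f x <= 1} ->
    exists2 h, Lipschitz_with 1 h & {ae m, forall x : borel X, f x = h x}.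

(* c is 1/N; c = 0 corresponds to N = +oo. *)
Definition weak_Bochner (K c : R) : Prop :=
  forall f lf g lg, is_laplacian f lf -> W1 2 lf ->
    is_laplacian g lg -> Lp +oo%E g ->
    {ae m, forall x : borel X, 0 <= g x} -> Lp +oo%E lg ->
    2^-1 * (\int[m]_x (wgrad f x ^+ 2 * lg x)) -
      \int[m]_x (grad_ip f lf x * g x) >=
    K * (\int[m]_x (wgrad f x ^+ 2 * g x)) +
      c * (\int[m]_x (lf x ^+ 2 * g x)).

(* [RCD_infty K] is RCD(K,oo). *)
Definition RCD_infty (K : R) : Prop :=
  [/\ infinitesimally_Hilbertian, volume_growth, Sobolev_to_Lipschitz &
      weak_Bochner K 0].

Definition RCD (K N : R) : Prop := RCD_infty K /\ weak_Bochner K N^-1.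

End mms.

(* Main.v *)
Require Import Defs.
From mathcomp Require Import all_boot all_order all_algebra.
From mathcomp Require Import all_classical all_reals all_analysis.
From mathcomp Require Import measurable_realfun ess_sup_inf ring lra.

Import Order.TTheory GRing.Theory Num.Theory.
Import numFieldNormedType.Exports.

Local Open Scope classical_set_scope.
Local Open Scope ring_scope.

(* [W2star] only asks for some weak upper gradient in the Sobolev class, not for
   the minimal one, so the curvature-dimension condition plays no role.
   For f Lipschitz with constant L and supported in a ball B_r, take for G the
   product of L with a Lipschitz cutoff equal to 1 on B_(r+1): G is again Lipschitz
   with bounded support, so the construction applies to G as well. If the p-th
   moment is finite, so is the measure, Lipschitz functions are in L^p, and the
   constant L serves as G.
   What has to be checked is that a locally valid Lipschitz bound
   |f y - f x| <= G x * d(y, x), for y near x, makes G a weak upper gradient. Since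
   [metric_speed] is +oo where the metric derivative does not exist, it always
   dominates the upper limit of difference quotients, hence it suffices that for
   phi = f o gamma absolutely continuous
   |phi 1 - phi 0| <= \int_0^1 limsup_n n |phi(t + 1/n) - phi t| dt,
   which comes from Fatou's lemma applied to the differences with the quotients
   of the primitive of a function dominating the increments of phi. *)

(** * Comparison of integrals of nonnegative functions *)

Section lower_integral.
Context d (T : measurableType d) (R : realType).
Variable mu : {measure set T -> \bar R}.
Local Open Scope ereal_scope.

(* No measurability is needed because the integral of a nonnegative function is
   a supremum over the simple functions below it. *)
Lemma ge0_le_lower_integral (D : set T) (f g : T -> \bar R) :
  (forall x, D x -> 0 <= f x) -> (forall x, D x -> f x <= g x) ->
  \int[mu]_(x in D) f x <= \int[mu]_(x in D) g x.
Proof.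
move=> f0 fg.
have g0 x : D x -> 0 <= g x by move=> Dx; exact: le_trans (f0 _ Dx) (fg _ Dx).
rewrite !ge0_integralE//; apply: ereal_sup_le => _ [h /= hf <-].
exists h => // x; apply: (le_trans (hf x)); rewrite !patchE.
by case: ifPn => // /set_mem; exact: fg.
Qed.

(** Measurability of [f] lets its integral be restricted to the complement of a null set, where [f]
    is below [g] pointwise. [g] is arbitrary because it will be a path integral, seen as a function
    of the curve. *)
Lemma ae_ge0_le_lower_integral (f g : T -> \bar R) :
  measurable_fun setT f -> (forall x, 0 <= f x) -> (forall x, 0 <= g x) ->
  {ae mu, forall x, f x <= g x} ->
  \int[mu]_x f x <= \int[mu]_x g x.
Proof.
move=> mf f0 g0 [N [mN muN0 subN]].
rewrite (ge0_negligible_integral _ _ _ _ muN0)// setTD integral_mkcond.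
apply: ge0_le_lower_integral => [x _|x _]; rewrite patchE; case: ifPn => // /set_mem.
by move=> xN; apply: contrapT => /= fgx; apply/xN/subN.
Qed.

End lower_integral.

(** * Lower and upper limits of extended real sequences *)

Section limn_einf_extra.
Context {R : realType}.
Local Open Scope ereal_scope.
Implicit Types (u v : (\bar R)^nat).

Lemma limn_einf_le_near u (c : R) :
  (forall e : R, (0 < e)%R -> \forall n \near \oo, u n <= (c + e)%:E) ->
  limn_einf u <= c%:E.
Proof.
move=> uc; rewrite limn_einf_lim; apply/lee_addgt0Pr => e e0.
rewrite -EFinD; apply: lime_le; first exact: is_cvg_einfs.
near=> n; apply: (@le_trans _ _ (u n)).
  by apply: ereal_inf_lbound; exists n => /=.
by near: n; exact: uc.
Unshelve. all: by end_near. Qed.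

Lemma limn_einf_ge0 u : (forall n, 0 <= u n) -> 0 <= limn_einf u.
Proof.
move=> u0; rewrite limn_einf_lim; apply: lime_ge; first exact: is_cvg_einfs.
by apply: nearW => n; apply: le_ereal_inf_tmp => _ [k _ <-].
Qed.

Lemma limn_esup_ge0 u : (forall n, 0 <= u n) -> 0 <= limn_esup u.
Proof.
by move=> u0; rewrite (le_trans (limn_einf_ge0 _ u0))// limn_einf_sup.
Qed.

Lemma limn_esup_le_cvg_near u v l : v @ \oo --> l ->
  (\forall n \near \oo, u n <= v n) -> limn_esup u <= l.
Proof.
move=> vl [N _ uv]; rewrite limn_esup_lim.
rewrite -(cvg_lim _ (cvg_esups vl))//.
apply: lee_lim; [exact: is_cvg_esups|exact: is_cvg_esups|].
exists N => // n /= Nn; apply: ge_ereal_sup => _ [k /= nk <-].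
apply: (@le_trans _ _ (v k)); first exact/uv/(leq_trans Nn).
by apply: ereal_sup_ubound; exists k.
Qed.

(** If limsup u = r is finite, then u_n <= r + e/2 eventually, so r + v_n >= l - e eventually. If it
    is +oo, so is the right-hand side, since liminf v >= 0. *)
Lemma cvg_le_limn_esupD (u v : R^nat) (l : R) :
  (forall n, 0 <= u n)%R -> (forall n, 0 <= v n)%R ->
  (fun n => u n + v n)%R @ \oo --> l ->
  l%:E <= limn_esup (EFin \o u) + limn_einf (EFin \o v).
Proof.
move=> u0 v0 uvl.
have Eu0 n : 0 <= (EFin \o u) n by rewrite lee_fin.
have Ev0 n : 0 <= (EFin \o v) n by rewrite lee_fin.
have [->|uoo] := eqVneq (limn_esup (EFin \o u)) +oo.
  by rewrite addye ?leey// gt_eqF// (lt_le_trans _ (limn_einf_ge0 _ Ev0)).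
have ufin : limn_esup (EFin \o u) \is a fin_num.
  by rewrite ge0_fin_numE ?limn_esup_ge0// lt_neqAle uoo leey.
rewrite -(fineK ufin); set r := fine _.
have ur : forall e, (0 < e)%R -> \forall n \near \oo, (u n <= r + e)%R.
  move=> e e0.
  have : ereal_inf (range (esups (EFin \o u))) < (r + e)%:E.
    rewrite -(cvg_lim _ (@cvg_esups_inf _ (EFin \o u)))// -limn_esup_lim.
    by rewrite -(fineK ufin) lte_fin ltrDl.
  move=> /ereal_inf_lt[_ [N _ <-]] Nr; exists N => // k /= Nk.
  rewrite -lee_fin (le_trans _ (ltW Nr))//; apply: ereal_sup_ubound.
  by exists k.
rewrite -limn_einf_shift// limn_einf_lim; apply/lee_subgt0Pr => e e0.
apply: lime_ge; first exact: is_cvg_einfs.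
have e20 : (0 < e / 2)%R by rewrite divr_gt0.
have [N _ uN] := ur _ e20.
have /cvgrPdist_le/(_ _ e20)[M _ uM] := uvl.
exists (maxn N M) => // n /=; rewrite geq_max => /andP[Nn Mn].
apply: le_ereal_inf_tmp => _ [k /= nk <-].
rewrite lee_fin.
have := uN _ (leq_trans Nn nk); have := uM _ (leq_trans Mn nk).
rewrite ler_norml => /andP[] *; lra.
Qed.

End limn_einf_extra.

(** * Integrals of shifted continuous functions *)

Section shift.
Context {R : realType}.
Notation mu := (@lebesgue_measure R).

Lemma continuous_integrable_itv (g : R -> R) (a b : R) : continuous g ->
  mu.-integrable `[a, b] (EFin \o g).
Proof.
move=> cg; apply: continuous_compact_integrable; first exact: segment_compact.
exact: continuous_subspaceT.
Qed.

(** One [P] serves every shift, so that integrals over different intervals can be subtracted. The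
    base point [c] lies strictly to the left of all points used, which makes [P] differentiable at
    the endpoints too. *)
Lemma Rintegral_shift_antiderivative (g : R -> R) (c : R) : continuous g ->
  exists P : R -> R, forall a b h, c < a + h -> a < b ->
  \int[mu]_(t in `[a, b]) g (t + h) = P (b + h) - P (a + h).
Proof.
move=> cg.
have [P dP] : exists P : R -> R, forall x, c < x -> derivable P x 1 /\ derive1 P x = g x.
  exists (fun x => \int[mu]_(t in `[c, x]) g t) => x cx.
  apply: (@continuous_FTC1_closed _ g c x (x + 1)) => //.
  - by rewrite ltrDl.
  - exact: continuous_integrable_itv.
  - exact: cg.
exists P => a b h cah ab.
have cgh : continuous (fun t => g (t + h)).
  move=> t; apply: continuous_comp; last exact: cg.
  by apply: cvgD; [exact: cvg_id|exact: cvg_cst].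
have dPh x : a <= x -> is_derive x 1 (fun t => P (t + h)) (g (x + h)).
  move=> ax; have [d1 d2] : derivable P (x + h) 1 /\ derive1 P (x + h) = g (x + h).
    by apply: dP; rewrite (lt_le_trans cah)// lerD2r.
  have dPx : is_derive (x + h) 1 P (g (x + h)).
    by apply: DeriveDef => //; rewrite -derive1E.
  have dsh : is_derive x 1 (shift h) (1 : R) by exact: is_derive_shift.
  by have := @is_derive1_comp _ P (shift h) x _ _ dPx dsh; rewrite mulr1.
have cPh x : a <= x -> {for x, continuous (fun t => P (t + h))}.
  move=> ax; apply: differentiable_continuous; apply/derivable1_diffP.
  by have := dPh _ ax => -[].
rewrite /Rintegral (@continuous_FTC2 _ _ (fun t => P (t + h)))//.
- exact: continuous_subspaceT.
- split.
  + by move=> x; rewrite in_itv => /andP[/ltW ax _]; have := dPh _ ax => -[].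
  + by apply/cvg_at_right_filter/cPh.
  + by apply/cvg_at_left_filter/cPh/ltW.
- move=> x; rewrite in_itv => /andP[/ltW ax _].
  by rewrite derive1E; have := dPh _ ax => -[].
Qed.

(** Both sides are P (1 + h) - P h - P 1 + P 0 for an antiderivative [P] based at -1. *)
Lemma Rintegral_increment (g : R -> R) (h : R) : continuous g -> 0 < h ->
  \int[mu]_(t in `[0, 1]) (g (t + h) - g t) =
  \int[mu]_(t in `[1, 1 + h]) g t - \int[mu]_(t in `[0, h]) g t.
Proof.
move=> cg h0; have [P PE] := @Rintegral_shift_antiderivative g (-1) cg.
have P0E a b : -1 < a -> a < b -> \int[mu]_(t in `[a, b]) g t = P b - P a.
  move=> a1 ab; rewrite -[in RHS](addr0 b) -[in RHS](addr0 a) -PE ?addr0//.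
  by apply: eq_Rintegral => t _; rewrite addr0.
rewrite RintegralB//; last 2 first.
- apply: (@continuous_integrable_itv (fun t => g (t + h))) => t.
  apply: continuous_comp; last exact: cg.
  by apply: cvgD; [exact: cvg_id|exact: cvg_cst].
- exact: continuous_integrable_itv.
rewrite PE ?add0r ?P0E ?ltrDl//; try lra.
Qed.

End shift.

(** * Primitives of integrable functions *)

Section primitive.
Context {R : realType}.
Notation mu := (@lebesgue_measure R).

Lemma cvg_forward_quotient (F : R -> R) (x l : R) : is_derive x 1 F l ->
  (n.+1%:R * (F (x + n.+1%:R^-1) - F x)) @[n --> \oo] --> l.
Proof.
move=> -[dF <-]; have /cvgr_dnbhsP/(_ (@harmonic R)) := dF.
set f := (X in (_ -> X) -> _); move=> Ff.
have {Ff} : f.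
  apply: Ff; split; last exact: cvg_harmonic.
  by move=> n; rewrite gt_eqF// harmonic_gt0.
apply: cvg_trans; apply: near_eq_cvg; apply: nearW => n /=.
have scaler1 (h : R) : h *: (1 : R) = h by exact: mulr1.
by rewrite /harmonic/= invrK scaler1 (addrC x).
Qed.

(** [F] integrates [S] from -oo. Its continuity is the absolute continuity of the integral; the last
    item is Lebesgue differentiation along the steps 1/(n+1). *)
Lemma exists_primitive (S : R -> R) : mu.-integrable setT (EFin \o S) ->
  exists F : R -> R, [/\ continuous F,
    forall x y, x <= y -> F y - F x = \int[mu]_(t in `]x, y]) S t &
    {ae mu, forall x,
      (n.+1%:R * (F (x + n.+1%:R^-1) - F x)) @[n --> \oo] --> S x}].
Proof.
move=> intS; pose F x := \int[mu]_(t in `]-oo, x]) S t.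
have FB x y : x <= y -> F y - F x = \int[mu]_(t in `]x, y]) S t.
  by move=> xy; rewrite /F Rintegral_itvB//; exact: integrableS intS.
have FBle x y : x <= y -> `|F y - F x| <= \int[mu]_(t in `]x, y]) `|S t|.
  by move=> xy; rewrite FB// le_normr_Rintegral//; exact: integrableS intS.
have dF : {ae mu, forall x, derivable F x 1 /\ derive1 F x = S x}.
  apply: FTC1Ny => [y|]; first exact: integrableS intS.
  by apply: open_integrable_locally => //; exact: openT.
clearbody F.
exists F; split => //.
- move=> x; apply/cvgrPdist_lt => e e0.
  have [d [d0 dS]] := integral_normr_continuous intS e0.
  have {}dS u v : u <= v -> v - u < d -> \int[mu]_(t in `]u, v]) `|S t| < e.
    move=> uv vud; apply: dS => //; change (mu `]u, v]%classic < d%:E)%E.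
    rewrite lebesgue_measure_itv/= lte_fin; case: ifPn => _.
      by rewrite -EFinB lte_fin.
    by rewrite lte_fin.
  exists d => //= y; rewrite /ball/= ltr_norml => /andP[dxy xyd].
  have [xy|/ltW yx] := leP x y.
    by rewrite distrC (le_lt_trans (FBle _ _ xy))// dS//; lra.
  by rewrite (le_lt_trans (FBle _ _ yx))// dS//; lra.
- move: dF; apply: filterS; first exact: (ae_filter_ringOfSetsType mu).
  move=> x [dF SE]; apply: cvg_forward_quotient.
  by apply: DeriveDef => //; rewrite -derive1E.
Qed.

End primitive.

(** * Increments of an absolutely continuous real function *)

Section increment.
Context {R : realType}.
Notation mu := (@lebesgue_measure R).

Lemma Rintegral_cst_itv (c h r : R) : 0 < h ->
  \int[mu]_(t in `[c, c + h]) r = h * r.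
Proof.
move=> h0; rewrite Rintegral_cst//= -/mu mulrC; congr (_ * _).
have -> : mu `[c, c + h]%classic = h%:E.
  by rewrite lebesgue_measure_itv/= lte_fin ltrDl h0 -EFinB addrAC subrr add0r.
by [].
Qed.

Lemma Rintegral_right_average (g : R -> R) (c e : R) : continuous g -> 0 < e ->
  \forall h \near 0^'+, `|\int[mu]_(t in `[c, c + h]) g t - h * g c| <= h * e.
Proof.
move=> cg e0.
have /cvgrPdist_le/(_ _ e0)[d /= d0 gd] := cg c.
near=> h.
have h0 : 0 < h by near: h; exact: nbhs_right_gt.
have hd : h < d by near: h; exact: nbhs_right_lt.
have ig := @continuous_integrable_itv _ g c (c + h) cg.
have ic r : mu.-integrable `[c, c + h] (EFin \o cst r).
  by apply: continuous_integrable_itv => x; exact: cvg_cst.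
have igc : mu.-integrable `[c, c + h] (EFin \o (fun t => g t - g c)).
  exact: (integrableB _ ig (ic (g c))).
rewrite -!(Rintegral_cst_itv c _ _ h0) -RintegralB//; last exact: ic.
apply: (@le_trans _ _ (\int[mu]_(t in `[c, c + h]) `|g t - g c|)).
  exact: le_normr_Rintegral.
apply: le_Rintegral => //; [exact: (integrable_norm igc)|exact: ic|].
move=> t /=; rewrite in_itv/= => /andP[ct tch].
rewrite distrC gd//= ler0_norm ?subr_le0//; lra.
Unshelve. all: by end_near. Qed.

(** With a_n and b_n the quotients of [phi] and of a primitive of [s], and c_n = b_n - a_n >= 0, the
    limit b_n -> s gives s <= limsup a_n + liminf c_n almost everywhere. Fatou bounds the integral
    of liminf c_n by that of [s] minus |phi 1 - phi 0|, and the finite integral of [s] cancels. *)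
Lemma increment_le_limn_esup (phi s : R -> R) : continuous phi ->
  (forall t, 1 <= t -> phi t = phi 1) ->
  (forall t, 0 <= s t) -> mu.-integrable `[0, 1] (EFin \o s) ->
  (forall t u, 0 <= t -> t < u -> u <= 1 ->
    `|phi u - phi t| <= \int[mu]_(r in `[t, u]) s r) ->
  ((`|phi 1 - phi 0|)%:E <= \int[mu]_(t in `[0%R, 1%R])
     limn_esup (fun n => (n.+1%:R * `|phi (t + n.+1%:R^-1) - phi t|)%:E))%E.
Proof.
move=> cphi phi1 s0 ints phis.
(* Extension by zero makes the primitive constant after 1, as [phi] is, so it still dominates when t
   + 1/(n+1) exceeds 1. *)
pose S := s \_ `[0, 1].
have intS : mu.-integrable [set: R] (EFin \o S).
  by move: ints; rewrite integrable_mkcond//= restrict_EFin.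
have S0 t : 0 <= S t by rewrite /S patchE; case: ifPn.
have [F [cF FB dF]] := exists_primitive S intS.
have ndF x y : x <= y -> F x <= F y.
  by move=> xy; rewrite -subr_ge0 FB// Rintegral_ge0.
have F10 : F 1 - F 0 = \int[mu]_(t in `[0, 1]) s t.
  rewrite FB// Rintegral_itv_obnd_cbnd; last exact: integrableS intS.
  by apply: eq_Rintegral => t t01; rewrite /S patchE t01.
have F1 t : 1 <= t -> F t = F 1.
  move=> t1; apply/eqP; rewrite -subr_eq0 FB//; apply/eqP.
  rewrite (@eq_Rintegral _ _ _ _ _ (cst 0)) ?Rintegral_cst ?mul0r// => r.
  rewrite inE /= in_itv/= => /andP[r1 _].
  rewrite /S patchE memNset//= in_itv/= => /andP[_].
  by rewrite leNgt r1.
have phiF t u : 0 <= t -> t <= u -> `|phi u - phi t| <= F u - F t.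
  move=> t0; rewrite le_eqVlt => /predU1P[->|tu]; first by rewrite !subrr normr0.
  wlog u1 : u tu / u <= 1.
    move=> wl; have [u1|/ltW u1] := leP u 1; first exact: wl.
    have [t1|t1] := ltP t 1; last by rewrite !phi1 ?(F1 u) ?(F1 t)// !subrr normr0.
    by rewrite (phi1 u)// (F1 u)// wl.
  rewrite (le_trans (phis _ _ t0 tu u1))// (FB _ _ (ltW tu)).
  rewrite Rintegral_itv_obnd_cbnd; last exact: integrableS intS.
  rewrite le_eqVlt; apply/orP; left; apply/eqP/eq_Rintegral => r.
  rewrite inE/= in_itv/= => /andP[tr ru]; rewrite /S patchE mem_set//=.
  by rewrite in_itv/= (le_trans t0)// (le_trans ru).
pose h (n : nat) : R := n.+1%:R^-1.
have h0 n : 0 < h n by rewrite /h.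
have hn n : n.+1%:R * h n = 1 by rewrite /h divff.
pose a n t := n.+1%:R * `|phi (t + h n) - phi t|.
pose b n t := n.+1%:R * (F (t + h n) - F t).
have ab n t : 0 <= t -> a n t <= b n t.
  by move=> t0; rewrite ler_wpM2l// phiF// lerDl ltW.
have cshift (g : R -> R) c : continuous g -> continuous (fun t => g (t + c) - g t).
  move=> cg t; apply: cvgB; last exact: cg.
  apply: continuous_comp; last exact: cg.
  by apply: cvgD; [exact: cvg_id|exact: cvg_cst].
have ca n : continuous (a n).
  move=> t; apply: cvgM; first exact: cvg_cst.
  by apply: cvg_norm; exact: cshift.
have cb n : continuous (b n).
  by move=> t; apply: cvgM; [exact: cvg_cst|exact: cshift].
(* [b n t - a n t] for t in [0, 1], made nonnegative outside too. *)
pose c n t := `|b n t - a n t|.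
have cc n : continuous (c n).
  by move=> t; apply: cvg_norm; apply: cvgB; [exact: cb|exact: ca].
have inta n : mu.-integrable `[0, 1] (EFin \o a n).
  exact: continuous_integrable_itv.
have intb n : mu.-integrable `[0, 1] (EFin \o b n).
  exact: continuous_integrable_itv.
have intcE n : (\int[mu]_(t in `[0%R, 1%R]) (c n t)%:E)%E =
    (\int[mu]_(t in `[0, 1]) b n t - \int[mu]_(t in `[0, 1]) a n t)%:E.
  rewrite -RintegralB// /Rintegral fineK; last first.
    by apply: integrable_fin_num => //; exact: (integrableB _ (intb n) (inta n)).
  apply: eq_integral => t; rewrite inE/= in_itv/= => /andP[t0 _].
  by rewrite /c ger0_norm// subr_ge0 ab.
(* After the shift, integrals of [F] over [1, 1 + h n] and [0, h n] remain: [F] equals F 1 on the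
   first and is at least F 0 on the second. *)
have intbE n : \int[mu]_(t in `[0, 1]) b n t <= F 1 - F 0.
  rewrite /b RintegralZl//; last first.
    exact: (@continuous_integrable_itv _ _ 0 1 (cshift F (h n) cF)).
  rewrite Rintegral_increment//.
  have -> : \int[mu]_(t in `[1, 1 + h n]) F t = h n * F 1.
    rewrite -(Rintegral_cst_itv 1)//; apply: eq_Rintegral => t.
    by rewrite inE/= in_itv/= => /andP[/F1].
  have : h n * F 0 <= \int[mu]_(t in `[0, 0 + h n]) F t.
    rewrite -(Rintegral_cst_itv 0)//; apply: le_Rintegral => //.
    - by apply: continuous_integrable_itv => x; exact: cvg_cst.
    - exact: continuous_integrable_itv.
    - by move=> t /=; rewrite in_itv/= => /andP[/ndF].
  rewrite add0r => hF.
  have -> : F 1 - F 0 = n.+1%:R * (h n * F 1 - h n * F 0).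
    by rewrite -mulrBr mulrA hn mul1r.
  by rewrite ler_wpM2l// lerB.
(* The integral of [a n] dominates that of the signed quotient, whose boundary terms are exactly phi
   1 and the mean of [phi] over [0, h n], which is within [e] of phi 0. *)
have intaE (e : R) : 0 < e -> \forall n \near \oo,
    `|phi 1 - phi 0| - e <= \int[mu]_(t in `[0, 1]) a n t.
  move=> e0; have [d /= d0 dP] := Rintegral_right_average phi 0 e cphi e0.
  have /cvgrPdist_lt/(_ _ d0)[N _ hd] := @cvg_harmonic R.
  exists N => // n /= Nn.
  have {}hd : `|\int[mu]_(t in `[0, h n]) phi t - h n * phi 0| <= h n * e.
    by have := dP (h n) (hd _ Nn) (h0 n); rewrite add0r.
  have ip : mu.-integrable `[0, 1] (EFin \o (fun t => phi (t + h n) - phi t)).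
    exact: (@continuous_integrable_itv _ _ 0 1 (cshift phi (h n) cphi)).
  rewrite /a RintegralZl//; last exact: (integrable_norm ip).
  rewrite -(ler_pM2l (h0 n)) [leRHS]mulrA (mulrC (h n) n.+1%:R) hn mul1r.
  apply: (@le_trans _ _ `|\int[mu]_(t in `[0, 1]) (phi (t + h n) - phi t)|); last first.
    exact: le_normr_Rintegral.
  rewrite Rintegral_increment//.
  have -> : \int[mu]_(t in `[1, 1 + h n]) phi t = h n * phi 1.
    rewrite -(Rintegral_cst_itv 1)//; apply: eq_Rintegral => t.
    by rewrite inE/= in_itv/= => /andP[/phi1].
  rewrite mulrBr lerBlDr -{1}(gtr0_norm (h0 n)) -normrM mulrBr.
  set I := \int[mu]_(t in _) _ in hd *.
  have -> : h n * phi 1 - h n * phi 0 =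
    (h n * phi 1 - I) + (I - h n * phi 0) by rewrite subrKA.
  by rewrite (le_trans (ler_normD _ _))// lerD2l.
pose u t := limn_esup (fun n => (a n t)%:E).
pose l t := limn_einf (fun n => (c n t)%:E).
have mu0 : measurable_fun (`[0, 1]%classic : set R) u.
  apply: measurable_fun_limn_esup => n; apply/measurable_EFinP.
  by apply: measurable_funTS; exact: continuous_measurable_fun.
have ml : measurable_fun (`[0, 1]%classic : set R) l.
  apply: measurableT_comp => //; apply: measurable_fun_limn_esup => n.
  apply: measurableT_comp => //; apply/measurable_EFinP.
  by apply: measurable_funTS; exact: continuous_measurable_fun.
have u0 t : (0 <= u t)%E.
  by apply: limn_esup_ge0 => n; rewrite lee_fin mulr_ge0.
have l0 t : (0 <= l t)%E.
  by apply: limn_einf_ge0 => n; rewrite lee_fin normr_ge0.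
have fat : (\int[mu]_(t in `[0%R, 1%R]) l t <=
    (F 1 - F 0 - `|phi 1 - phi 0|)%:E)%E.
  apply: (@le_trans _ _ (limn_einf (fun n => \int[mu]_(t in `[0%R, 1%R]) (c n t)%:E)%E)).
    apply: (@fatou _ _ _ mu `[0, 1]%classic _ (fun n t => (c n t)%:E)) => //.
    - move=> n; apply/measurable_EFinP.
      by apply: measurable_funTS; exact: continuous_measurable_fun.
    - by move=> n t _; rewrite lee_fin normr_ge0.
  apply: limn_einf_le_near => e e0.
  have [N _ aN] := intaE _ e0; exists N => // n /= /aN an.
  by rewrite intcE lee_fin (le_trans (lerB (intbE n) an))// opprB addrA addrAC.
have key : (\int[mu]_(t in `[0%R, 1%R]) (s t)%:E <=
  \int[mu]_(t in `[0%R, 1%R]) u t + \int[mu]_(t in `[0%R, 1%R]) l t)%E.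
  rewrite -ge0_integralD//; apply: ae_ge0_le_integral => //.
  - by move=> t _; rewrite lee_fin.
  - exact: measurable_int ints.
  - by move=> t _; exact: adde_ge0.
  - exact: emeasurable_funD.
  (* On [0, 1] the sum of [a n] and [c n] is [b n], which converges to [s] almost everywhere. *)
  - move: dF; apply: filterS; first exact: (ae_filter_ringOfSetsType mu).
    move=> t bt /= t01; apply: cvg_le_limn_esupD => [n|n|].
    + by rewrite mulr_ge0.
    + exact: normr_ge0.
    + move: bt; rewrite /S patchE mem_set//; apply: cvg_trans.
      apply: near_eq_cvg; apply: nearW => n /=.
      move: t01; rewrite in_itv/= => /andP[t0 _].
      by rewrite /c ger0_norm ?subr_ge0 ?ab// subrKC.
have sE : (\int[mu]_(t in `[0%R, 1%R]) (s t)%:E = (F 1 - F 0)%:E)%E.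
  by rewrite F10 /Rintegral fineK//; exact: integrable_fin_num.
have := le_trans key (leeD2l _ fat); rewrite sE -/u.
(* F 1 - F 0 cancels when the integral of [u] is a real number; +oo is trivial and -oo absurd. *)
case: (\int[mu]_(t in _) u t)%E => [r| |].
- by rewrite -EFinD !lee_fin addrCA lerDl subr_ge0.
- by move=> _; rewrite leey.
- by rewrite addNye leeNy_eq.
Qed.

End increment.

(** * Continuity, Lipschitz bounds and Borel measurability *)

Lemma continuous_borel_measurable {R : realType} {T : ptopologicalType} (f : T -> R) :
  continuous f -> measurable_fun setT (f : borel T -> R).
Proof.
move=> /continuousP cf; apply: (measurability _ (RGenOpens.measurableE R)).
move=> _ [_ [a [b ->] <-]]; rewrite setTI.
by apply: sub_sigma_algebra; exact/cf/interval_open.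
Qed.

Section lipschitz.
Context {R : realType}.

Lemma near_mdist (Y : metricType R) (x : Y) (e : R) : 0 < e ->
  \forall y \near x, mdist x y < e.
Proof.
move=> e0; have := nbhsx_ballx x e e0; apply: filterS => y.
by rewrite ballEmdist.
Qed.

(** Stated for any metric space, to serve both on [X] and on the space of curves with the sup
    distance. *)
Lemma mdist_Lipschitz_continuous (Y : metricType R) (f : Y -> R) (L : R) :
  (forall x y, `|f x - f y| <= L * mdist x y) -> continuous f.
Proof.
move=> Lf x; apply/cvgrPdist_le => e e0.
(* A positive constant whatever the sign of [L]. *)
have L0 : 0 < `|L| + 1 by rewrite ltr_wpDl.
have : \forall y \near x, mdist x y < e / (`|L| + 1).
  by apply: near_mdist; rewrite divr_gt0.
apply: filterS => y; rewrite ltr_pdivlMr// => xy.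
rewrite (le_trans (Lf x y))// (le_trans _ (ltW xy))// mulrC.
by rewrite ler_wpM2l ?mdist_ge0// (le_trans (ler_norm _))// lerDl.
Qed.

Lemma ler_dist_mdist (Y : metricType R) (x y z : Y) :
  `|mdist x y - mdist x z| <= mdist y z.
Proof.
rewrite ler_norml; have := metric_triangle x y z; have := metric_triangle x z y.
by rewrite (metric_sym z y) => *; apply/andP; split; lra.
Qed.

Lemma mdist_continuous (Y : metricType R) (x : Y) : continuous (mdist x).
Proof.
apply: (@mdist_Lipschitz_continuous _ _ 1) => y z.
by rewrite mul1r ler_dist_mdist.
Qed.

Context {X : completeMetricType R}.

Lemma Lipschitz_with_norm (L : R) (f : X -> R) :
  Lipschitz_with L f -> Lipschitz_with `|L| f.
Proof.
by move=> Lf x y; rewrite (le_trans (Lf x y))// ler_wpM2r ?mdist_ge0// ler_norm.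
Qed.

Lemma Lipschitz_continuous (L : R) (f : X -> R) : Lipschitz_with L f -> continuous f.
Proof. exact: mdist_Lipschitz_continuous. Qed.

End lipschitz.

(** * The upper gradient inequality along a single curve *)

Section curves.
Context {R : realType} {X : completeMetricType R}.
Notation mu := (@lebesgue_measure R).
Implicit Types (g : curve X) (f G : X -> R).

(* [abs_continuous] for some exponent, or the Lipschitz bound of an oo-test plan,
   gives this common L^1 condition with an everywhere nonnegative density. *)
Definition absolutely_continuous g := exists2 s : R -> R,
  (forall t, 0 <= s t) /\ mu.-integrable `[0, 1] (EFin \o s) &
  forall t u : I01 R, val t < val u ->
    mdist (g u) (g t) <= \int[mu]_(r in `[val t, val u]) s r.

Lemma cvg_harmonic_at_right : (fun n => n.+1%:R^-1 : R) @ \oo --> 0^'+.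
Proof.
move=> A [d /= d0 dA]; have /cvgrPdist_lt/(_ _ d0)[N _ Nd] := @cvg_harmonic R.
by exists N => // n /= /Nd nd; apply: dA => //=.
Qed.

Lemma metric_speed_ge0 g t : (0 <= metric_speed g t)%E.
Proof.
rewrite /metric_speed; case: asboolP => [cvgq|]; last by rewrite leey.
apply: lime_ge => //; near=> h.
have h0 : 0 < h by near: h; exact: nbhs_right_gt.
by rewrite lee_fin divr_ge0 ?mdist_ge0// ltW.
Unshelve. all: by end_near. Qed.

Lemma continuous_curve g : continuous (fun t : R => g (clamp t)).
Proof.
move=> t; apply: (@continuous_comp _ _ _ (@clamp R) g); last exact: cts_fun.
exact: clamp_continuous.
Qed.

(** Where the metric derivative exists, the distance quotients at h = 1/(n+1) converge to it and the
    local bound passes to the limit; elsewhere the speed is +oo. *)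
Lemma limn_esup_le_metric_speed g f G : (forall x, 0 <= G x) ->
  (forall x, \forall y \near x, `|f y - f x| <= G x * mdist y x) ->
  forall t, (limn_esup (fun n =>
    (n.+1%:R * `|f (g (clamp (t + n.+1%:R^-1))) - f (g (clamp t))|)%:E) <=
    (G (g (clamp t)))%:E * metric_speed g t)%E.
Proof.
move=> G0 fG t; set x := g (clamp t).
pose v (h : R) := (mdist (g (clamp (t + h))) x / h)%:E.
have near0 : \forall h \near (0 : R)^'+,
    `|f (g (clamp (t + h))) - f x| <= G x * mdist (g (clamp (t + h))) x.
  have ch : g (clamp (t + h)) @[h --> (0 : R)] --> x.
    rewrite /x -[in clamp t](addr0 t).
    apply: (@continuous_comp _ _ _ (fun h : R => t + h) (fun t => g (clamp t))).
      by apply: cvgD; [exact: cvg_cst|exact: cvg_id].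
    exact: continuous_curve.
  exact: (cvg_at_right_filter ch) (fG x).
have nearn : \forall n \near \oo, ((n.+1%:R *
    `|f (g (clamp (t + n.+1%:R^-1))) - f x|)%:E <= (G x)%:E * v (n.+1%:R^-1)%R)%E.
  have [N _ Nf] := cvg_harmonic_at_right _ near0.
  exists N => // n /= /Nf /= fn.
  by rewrite -EFinM lee_fin invrK mulrA mulrC ler_wpM2r.
rewrite /metric_speed -/x; case: asboolP => [cvgv|_].
  apply: limn_esup_le_cvg_near nearn; apply: cvgeZl => //.
  exact: (cvg_comp _ _ cvg_harmonic_at_right cvgv).
(* If G x = 0, the product with +oo is 0; but then the local bound makes [f] constant near [x], so
   the quotients eventually vanish. *)
have := G0 x; rewrite le_eqVlt => /predU1P[Gx0|Gx0]; last first.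
  by rewrite gt0_muley ?lte_fin// leey.
rewrite -Gx0 mul0e; apply: limn_esup_le_cvg_near (cvg_cst _) _.
by apply: filterS nearn => n; rewrite -Gx0 mul0e.
Qed.

(** The global constant [L] only provides the absolute continuity of [f] along the curve, with
    density |L| s; the bound itself comes from the local one by [G]. *)
Lemma curve_increment_le g f G (L : R) : absolutely_continuous g ->
  Lipschitz_with L f -> (forall x, 0 <= G x) ->
  (forall x, \forall y \near x, `|f y - f x| <= G x * mdist y x) ->
  ((`|f (g (clamp 1)) - f (g (clamp 0))|)%:E <=
   \int[mu]_(t in [set` `[0%R, 1%R]]) ((G (g (clamp t)))%:E * metric_speed g t))%E.
Proof.
move=> [s [s0 ints] gs] /[dup] /Lipschitz_continuous cf /Lipschitz_with_norm Lf G0 fG.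
have val_clamp t : 0 <= t -> t <= 1 -> val (clamp t) = t :> R.
  by move=> t0 t1 /=; rewrite min_r// max_r.
pose s' t := `|L| * s t.
apply: (le_trans (@increment_le_limn_esup R (fun t => f (g (clamp t))) s' _ _ _ _ _)).
- move=> t; apply: continuous_comp; [exact: continuous_curve|exact: cf].
- move=> t t1; congr (f (g _)); apply/val_inj => /=.
  by rewrite (min_l t1) (min_l (lexx 1)).
- by move=> t; rewrite mulr_ge0.
- exact: (integrableZl _ _ ints).
- move=> t u t0 tu u1.
  rewrite (le_trans (Lf _ _))// RintegralZl//; last first.
    by apply: integrableS ints => //; apply: subset_itv; rewrite bnd_simp.
  rewrite ler_wpM2l//.
  have := gs (clamp t) (clamp u).
  rewrite !val_clamp//; first exact.
  - by rewrite (le_trans t0)// ltW.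
  - by rewrite (le_trans _ u1)// ltW.
- apply: ge0_le_lower_integral => t _; last exact: limn_esup_le_metric_speed.
  by apply: limn_esup_ge0 => n; rewrite lee_fin mulr_ge0.
Qed.

End curves.

(** * Test plans and weak upper gradients *)

Section test_plans.
Context {R : realType} {X : completeMetricType R}.
Notation mu := (@lebesgue_measure R).
Variable m : {measure set (borel X) -> \bar R}.
Implicit Types (g : curve X) (f G : X -> R).

Lemma mrestr_integrable (D : set R) (mD : measurable D) (s : R -> R) :
  (mrestr mu mD).-integrable setT (EFin \o s) -> mu.-integrable D (EFin \o s).
Proof.
move=> /integrableP[ms sfin]; apply/integrableP; split; first exact: measurable_funTS.
have -> : (\int[mu]_(x in D) `|(EFin \o s) x| =
    \int[mrestr mu mD]_(x in D) `|(EFin \o s) x|)%E.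
  apply: eq_measure_integral => A mA AD /=.
  by rewrite /mrestr setIidl.
apply: le_lt_trans sfin; apply: ge0_subset_integral => //.
exact: measurableT_comp.
Qed.

(** [0, 1] has finite measure, so an L^q density is in L^1; its absolute value is nonnegative
    everywhere. *)
Lemma abs_continuous_absolutely_continuous (q : \bar R) g : (1 <= q)%E ->
  abs_continuous q g -> absolutely_continuous g.
Proof.
move=> q1 [s sq gs].
have s1 : s \in Lfun (mrestr lebesgue_measure (measurable_itv `[0, (1 : R)])) 1%E.
  apply: Lfun_subset sq => //.
  by rewrite /= /mrestr setTI; rewrite lebesgue_measure_itv/= lte_fin ltr01.
have ints : mu.-integrable `[0, 1] (EFin \o s).
  exact/mrestr_integrable/Lfun1_integrable.
exists (fun t => `|s t|); first by split => //; exact: (integrable_norm ints).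
move=> t u tu; rewrite -lee_fin.
have tu01 : `[val t, val u]%classic `<=` `[0, (1 : R)]%classic.
  apply: subset_itv; rewrite bnd_simp.
    by have := valP t; rewrite inE/= in_itv/= => /andP[].
  by have := valP u; rewrite inE/= in_itv/= => /andP[].
have intn : mu.-integrable `[val t, val u] (EFin \o (fun t => `|s t|)).
  by apply: (@integrableS _ _ _ mu `[0, 1]%classic) => //; exact: (integrable_norm ints).
rewrite /Rintegral fineK; last exact: integrable_fin_num intn.
apply: (le_trans (gs t u tu)); apply: le_integral => //.
- by apply: integrableS ints.
- by move=> x _; rewrite lee_fin ler_norm.
Qed.

Lemma curve_lip_absolutely_continuous (M : R) g :
  (curve_lip g <= M%:E)%E -> absolutely_continuous g.
Proof.
move=> gM; exists (fun=> `|M|).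
  by split => //; apply: continuous_integrable_itv => x; exact: cvg_cst.
move=> t u tu; have ut0 : 0 < val u - val t by rewrite subr_gt0.
have -> : \int[mu]_(r in `[val t, val u]) `|M| = (val u - val t) * `|M|.
  by rewrite -[X in `[_, X]](subrK (val t)) [_ + val t]addrC Rintegral_cst_itv.
have : ((mdist (g t) (g u) / (val u - val t))%:E <= M%:E)%E.
  by apply: le_trans gM; apply: ereal_sup_ubound; exists t, u.
rewrite lee_fin ler_pdivrMr// metric_sym => /le_trans; apply.
by rewrite [leRHS]mulrC ler_pM2r// ler_norm.
Qed.

(** For a finite exponent, the integrable [kinetic_energy] is almost everywhere finite, and it is
    +oo off [abs_continuous]. For +oo, almost every curve has Lipschitz constant at most the
    essential supremum. *)
Lemma test_plan_absolutely_continuous (p : R) (pi : probability (borel (curve X)) R) :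
  1 <= p -> test_plan m (hoelder_conjugate p%:E) pi ->
  {ae pi, forall g : borel (curve X), absolutely_continuous g}.
Proof.
move=> p1; have : (1 <= hoelder_conjugate p%:E)%E.
  by apply: hoelder_conj_ge1; rewrite lee_fin.
case: (hoelder_conjugate _) => [q q1 [_ iK]|_ [_ [_]]|//].
- have /integrable_ae := iK; move=> /(_ measurableT); apply: filterS => g /(_ I).
  rewrite /kinetic_energy; case: asboolP => // gac _.
  exact: abs_continuous_absolutely_continuous gac.
(* The norm of exponent +oo is the essential supremum only when the total mass is positive. *)
- have piT : (0 < pi [set: borel (curve X)])%E by rewrite probability_setT.
  rewrite unlock /Lnorm piT => supfin.
  have := ess_sup_ge pi (abse \o @curve_lip R X); apply: filterS => g /=.
  set M := ess_sup _ _ in supfin *; move=> gM.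
  have Mfin : M \is a fin_num.
    by rewrite ge0_fin_numE// (le_trans _ gM).
  apply: (@curve_lip_absolutely_continuous (fine M)).
  by rewrite fineK// (le_trans _ gM)// lee_abs.
Qed.

(** [curve_increment_le] applies to almost every curve of a test plan and is integrated over the
    plan. *)
Lemma locally_Lipschitz_UG (p L : R) f G : 1 <= p ->
  Lipschitz_with L f -> continuous G -> (forall x, 0 <= G x) ->
  (forall x, \forall y \near x, `|f y - f x| <= G x * mdist y x) ->
  UG m p f G.
Proof.
move=> p1 Lf cG G0 fG; split => //.
- by apply: continuous_borel_measurable; exact: Lipschitz_continuous Lf.
- exact: continuous_borel_measurable.
move=> pi /(test_plan_absolutely_continuous _ _ p1) acpi.
have Lev t (g h : curve X) : `|f (g t) - f (h t)| <= `|L| * mdist g h.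
  rewrite (le_trans (Lipschitz_with_norm _ _ Lf _ _))// ler_wpM2l//.
  exact: mdist_le_curve_dist.
apply: ae_ge0_le_lower_integral => [||g|].
(* The left-hand integrand is Lipschitz in the curve for the sup distance, hence Borel. *)
- apply/measurable_EFinP.
  apply: continuous_borel_measurable.
  apply: (@mdist_Lipschitz_continuous _ _ _ (`|L| + `|L|)) => g h.
  rewrite (le_trans (ler_dist_dist _ _))//.
  have -> : f (g (clamp 1)) - f (g (clamp 0)) - (f (h (clamp 1)) - f (h (clamp 0))) =
    (f (g (clamp 1)) - f (h (clamp 1))) - (f (g (clamp 0)) - f (h (clamp 0))) by ring.
  by rewrite (le_trans (ler_normB _ _))// mulrDl lerD.
- by move=> g; rewrite lee_fin.
- by apply: integral_ge0 => t _; rewrite mule_ge0 ?lee_fin// metric_speed_ge0.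
- move: acpi; apply: filterS; first exact: (ae_filter_ringOfSetsType pi).
  by move=> g acg; exact: curve_increment_le Lf G0 fG.
Qed.

End test_plans.

(** * Membership in L^p and in the Sobolev spaces *)

Section W2star_membership.
Context {R : realType} {X : completeMetricType R}.
Variable m : {measure set (borel X) -> \bar R}.
Implicit Types (f G : X -> R).

Lemma Lp_of_bound (p : R) f (h : X -> \bar R) : 1 <= p -> continuous f ->
  (forall x, (`|f x| `^ p)%:E <= h x)%E -> (\int[m]_x h x < +oo)%E ->
  Lp m p%:E f.
Proof.
move=> p1 cf fh hfin; rewrite /Lp/= inE; apply/andP; split; rewrite inE/=.
  exact: continuous_borel_measurable.
rewrite /finite_norm unlock poweR_lty//; apply: le_lt_trans hfin.
by apply: ge0_le_lower_integral => x _; rewrite /= ?lee_fin ?powR_ge0.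
Qed.

Lemma measurable_mdist_ball (x : X) (r : R) :
  measurable (ball x r : set (borel X)).
Proof.
apply: sub_sigma_algebra; rewrite ballEmdist.
have /continuousP/(_ _ (@open_lt _ r)) := mdist_continuous _ x.
by congr open.
Qed.

Lemma Lipschitz_with_bound (L : R) f (x0 y : X) : Lipschitz_with L f ->
  `|f y| <= `|f x0| + `|L| * mdist y x0.
Proof.
move=> /Lipschitz_with_norm Lf.
by rewrite -lerBlDl (le_trans _ (Lf y x0))// lerB_dist.
Qed.

(** [f] is bounded by [M] on a ball of finite measure and vanishes outside it. *)
Lemma Lip_bs_Lp (p : R) f : metric_measure_space m -> 1 <= p ->
  Lip_bs f -> Lp m p%:E f.
Proof.
move=> [_ _ mfin _] p1 [[L Lf] [B [x0 [r Br]] f0]].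
pose M := `|f x0| + `|L| * r.
apply: (@Lp_of_bound _ _ ((cst (M `^ p)%:E) \_ (ball x0 r))) => //.
- exact: Lipschitz_continuous Lf.
- move=> y; rewrite patchE; case: ifPn => [/set_mem yr|/negP yr].
    have d_r : mdist x0 y < r by move: yr; rewrite ballEmdist.
    have fM : `|f y| <= M.
      rewrite (le_trans (Lipschitz_with_bound _ _ x0 _ Lf))// lerD2l//.
      by rewrite ler_wpM2l// metric_sym ltW.
    rewrite lee_fin ge0_ler_powR// ?nnegrE//; first exact: le_trans p1.
    exact: le_trans fM.
  rewrite f0 ?normr0 ?powR0//.
    by rewrite gt_eqF// (lt_le_trans _ p1).
  by move=> By; apply: yr; rewrite inE; exact: Br.
- rewrite -integral_mkcond integral_cst; last exact: measurable_mdist_ball.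
  rewrite lte_mul_pinfty ?lee_fin ?powR_ge0//.
  apply: mfin; first exact: measurable_mdist_ball.
  by exists x0, r.
Qed.

Lemma clip_Lipschitz (a b : R) :
  `|Num.max 0 (Num.min 1 a) - Num.max 0 (Num.min 1 b)| <= `|a - b|.
Proof.
have ab := ler_norm (a - b); have ba := ler_norm (b - a); rewrite distrC in ba.
rewrite ler_norml; apply/andP.
case: (leP 1 a) => a1; case: (leP 1 b) => b1; rewrite ?(max_r ler01).
- by split; lra.
- by case: (leP 0 b) => b0; split; lra.
- by case: (leP 0 a) => a0; split; lra.
- by case: (leP 0 a) => a0; case: (leP 0 b) => b0; split; lra.
Qed.

(** Since [G] is again in [Lip_bs], the lemma applies to it in turn, which places [G] in [W1]. *)
Lemma Lip_bs_UG (p : R) f : 1 <= p -> Lip_bs f ->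
  exists2 G, Lip_bs G & UG m p f G.
Proof.
move=> p1 [[L Lf] [B [x0 [r Br]] f0]].
have f_out y : r <= mdist x0 y -> f y = 0.
  by move=> ry; apply: f0 => /Br; rewrite ballEmdist/= ltNge ry.
(* Equal to 1 up to distance r + 1 from [x0] and to 0 from r + 2 on. *)
pose cutoff y := Num.max 0 (Num.min 1 (r + 2 - mdist x0 y)).
have c0 y : 0 <= cutoff y by rewrite le_max lexx.
pose G y := `|L| * cutoff y.
have GL : Lipschitz_with `|L| G.
  move=> y z; rewrite /G -mulrBr normrM normr_id ler_wpM2l//.
  apply: (le_trans (clip_Lipschitz _ _)).
  by rewrite opprD addrACA subrr add0r -opprD normrN ler_dist_mdist.
have G0 y : 0 <= G y by rewrite mulr_ge0.
exists G.
  split; first by exists `|L|.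
  exists (ball x0 (r + 2)); first by exists x0, (r + 2).
  move=> y; rewrite ballEmdist/= => /negP; rewrite -leNgt => ry.
  rewrite /G /cutoff max_l ?mulr0// ge_min; apply/orP; right.
  by rewrite subr_le0.
apply: (@locally_Lipschitz_UG _ _ _ _ L) => //; first exact: Lipschitz_continuous GL.
move=> x; have [xr|rx] := leP (mdist x0 x) (r + 1).
  apply: nearW => y; rewrite /G.
  have -> : cutoff x = 1.
    by rewrite /cutoff min_l ?max_r//; lra.
  by rewrite mulr1 (Lipschitz_with_norm _ _ Lf).
(* Here [G] may be smaller than |L|, but the unit ball around [x] misses the ball of radius [r], so
   [f] vanishes on it. *)
have := near_mdist _ x 1 ltr01; apply: filterS => y xy.
have dxy : mdist x0 x <= mdist x0 y + mdist y x := metric_triangle _ _ _.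
rewrite metric_sym in xy.
rewrite !f_out ?subrr ?normr0 ?mulr_ge0 ?mdist_ge0//; lra.
Qed.

Lemma Lip_bs_W1 (p : R) f : metric_measure_space m -> 1 <= p ->
  Lip_bs f -> W1 m p f.
Proof.
move=> mmsX p1 fbs; split; first exact: Lip_bs_Lp.
by have [G Gbs fG] := Lip_bs_UG _ _ p1 fbs; exists G; split => //; exact: Lip_bs_Lp.
Qed.

(** The unit ball is bounded, hence of finite measure; outside it the p-th power of the distance is
    at least 1, so the moment bounds the remaining mass. *)
Lemma finite_moment_finite_measure (p : R) (x0 : X) : metric_measure_space m ->
  0 <= p -> (\int[m]_x (mdist x x0 `^ p)%:E < +oo)%E -> (m setT < +oo)%E.
Proof.
move=> [_ _ mfin _] p0 pfin; have mb := measurable_mdist_ball x0 1.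
have -> : m setT = (m (ball x0 1) + m (~` ball x0 1))%E.
  rewrite -measureU ?setUv ?setICr//; exact: measurableC.
apply: lte_add_pinfty; first by apply: mfin => //; exists x0, 1.
apply: le_lt_trans pfin.
rewrite -[leLHS]mul1e -integral_cst//; last exact: measurableC.
rewrite integral_mkcond; apply: ge0_le_lower_integral => x _; rewrite patchE.
  by case: ifPn.
case: ifPn => [/set_mem|_]; last by rewrite lee_fin powR_ge0.
rewrite ballEmdist/= => /negP; rewrite -leNgt metric_sym lee_fin => d1.
by have := @ge0_ler_powR _ _ p0 _ _ ler01 (mdist_ge0 x x0) d1; rewrite powR1.
Qed.

(** From |f x| <= C max(1, d(x, x0)) follows |f x|^p <= C^p (1 + d(x, x0)^p), whose integral is
    finite because the measure is finite too. *)
Lemma finite_moment_Lip_Lp (p : R) (x0 : X) f : metric_measure_space m ->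
  1 <= p -> (\int[m]_x (mdist x x0 `^ p)%:E < +oo)%E -> Lip f -> Lp m p%:E f.
Proof.
move=> mmsX p1 pfin [L Lf]; have p0 : 0 <= p by exact: le_trans p1.
have mfin := finite_moment_finite_measure _ _ mmsX p0 pfin.
pose C := `|f x0| + `|L|.
have md : measurable_fun setT (fun x : borel X => (mdist (x : X) x0 `^ p)%:E).
  apply/measurable_EFinP; apply: (measurableT_comp (measurable_powR p)).
  apply: continuous_borel_measurable.
  have -> : (fun x : X => mdist x x0) = mdist x0.
    by apply/funext => x; exact: metric_sym.
  exact: mdist_continuous.
apply: (@Lp_of_bound _ _ (fun x => (C `^ p)%:E * (1 + (mdist x x0 `^ p)%:E))%E) => //.
- exact: Lipschitz_continuous Lf.
- move=> x; rewrite -EFinD -EFinM lee_fin.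
  have fC : `|f x| <= C * Num.max 1 (mdist x x0).
    rewrite (le_trans (Lipschitz_with_bound _ _ x0 _ Lf))// mulrDl lerD//.
      by rewrite ler_peMr// le_max lexx.
    by rewrite ler_wpM2l// le_max lexx orbT.
  apply: (@le_trans _ _ ((C * Num.max 1 (mdist x x0)) `^ p)).
    by rewrite ge0_ler_powR// nnegrE// (le_trans _ fC).
  rewrite powRM ?addr_ge0// ?le_max ?ler01// ler_wpM2l ?powR_ge0//.
  case: (leP 1 (mdist x x0)) => _; first by rewrite lerDr.
  by rewrite powR1 lerDl powR_ge0.
- rewrite ge0_integralZl_EFin ?powR_ge0//; last 2 first.
  + by move=> x _; rewrite adde_ge0// lee_fin powR_ge0.
  + exact: emeasurable_funD.
  rewrite lte_mul_pinfty ?lee_fin ?powR_ge0//.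
  rewrite ge0_integralD//; last by move=> x _; rewrite lee_fin powR_ge0.
  by rewrite integral_cst// mul1e lte_add_pinfty.
Qed.

Lemma Lip_UG_cst (p L : R) f : 1 <= p -> Lipschitz_with L f ->
  UG m p f (cst `|L|).
Proof.
move=> p1 Lf; apply: (@locally_Lipschitz_UG _ _ _ _ L) => //.
- by move=> x; exact: cvg_cst.
- by move=> x; rewrite /= normr_ge0.
- by move=> x; apply: nearW => y; exact: Lipschitz_with_norm.
Qed.

Lemma Lip_cst (c : R) : @Lip R X (cst c).
Proof. by exists 0 => x y; rewrite subrr normr0 mul0r. Qed.

End W2star_membership.

Theorem mainTheorem5 (R : realType) (X : completeMetricType R)
    (m : {measure set (borel X) -> \bar R}) (K N p : R)
    (mmsX : metric_measure_space m) (N_ge1 : 1 <= N) (rcdX : RCD m K N)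
    (p_ge1 : 1 <= p) :
  (@Lip_bs R X `<=` W2star m p) /\
  ((exists x0 : X, (\int[m]_x (mdist x x0 `^ p)%:E < +oo)%E) ->
   @Lip R X `<=` W2star m p).
Proof.
split=> [f fbs|[x0 pfin] f fLip].
  split; first exact: Lip_bs_W1.
  have [G Gbs fG] := Lip_bs_UG m _ _ p_ge1 fbs.
  by exists G; split => //; exact: Lip_bs_W1.
(* Serves twice: for [f] and for its weak upper gradient, the constant |L|, which is itself
   Lipschitz. *)
have W1Lip g : Lip g -> W1 m p g.
  move=> gLip; split; first exact: (@finite_moment_Lip_Lp _ _ _ _ x0).
  have [L Lg] := gLip; exists (cst `|L|); split; first exact: Lip_UG_cst.
  by apply: (@finite_moment_Lip_Lp _ _ _ _ x0) => //; exact: Lip_cst.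
split; first exact: W1Lip.
have [L Lf] := fLip; exists (cst `|L|); split; first exact: Lip_UG_cst.
by apply: W1Lip; exact: Lip_cst.
Qed.
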